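(* Let $\mu_1,\dots,\mu_k$ be discrete distributions on $\mathbb{R}^d$, each supported on at most $\mathrm{poly}(n)$ points, and let $\varepsilon,\delta\in(0,1)$. Let $\pi:\mathbb{R}^d\to\mathbb{R}^m$ be a JL projection with $m=O(\log(nk/\delta)/\varepsilon^2)$. Then \[\mathbb{P}\Big(\mathrm{cost}_2(\pi S)\in[(1-\varepsilon)^2\,\mathrm{cost}_2(S),\,(1+\varepsilon)^2\,\mathrm{cost}_2(S)]\ \text{for all solutions } S\Big)\ge 1-\delta.\]
   Context: Wasserstein barycenter problem with support size at most $n$: minimize $\frac1k\sum_i W_p(\mu_i,\nu)^p$ over $\nu$ supported on at most $n$ points. Write $\mu_i=\sum_x a(x)\delta_x$. A solution $(S,w)=(S_1,\dots,S_n,w_1,\dots,w_n)$ comes from the optimal couplings of each $\mu_i$ to a fixed $\nu=\sum_{j=1}^n b_j\delta_{\nu^j}$: $w_j(x)\ge0$ is the mass sent from point $x$ to $\nu^j$ and $S_j=\{x: w_j(x)>0\}$. $\mathrm{cost}_p(S)=\min_{\nu^j\in\mathbb{R}^d}\frac1k\sum_j\sum_{x\in S_j}w_j(x)\|x-\nu^j\|^p$ and $\mathrm{cost}_p(\pi S)=\min_{\tilde\nu^j\in\mathbb{R}^m}\frac1k\sum_j\sum_{x\in S_j}w_j(x)\|\pi(x)-\tilde\nu^j\|^p$. A JL projection is a random linear map (e.g. scaled Gaussian or sub-Gaussian matrix) satisfying the Johnson–Lindenstrauss lemma guarantee: for any fixed set of $N$ points, with probability $1-\delta$ all pairwise distances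 are preserved up to a factor $1\pm\varepsilon$ when $m=O(\log(N/\delta)/\varepsilon^2)$.
   Formalization: The formal theorem assumes nk > 1, excluding n = k = 1: there log(nk/δ) = log(1/δ) tends to 0 as δ → 1 while the support may still have several points, so no constant in m = O(log(nk/δ)/ε²) lets the JL guarantee give the claim. *)

(* Defs.v *)
From HB Require Import structures.
From mathcomp Require Import all_boot all_order all_algebra.
From mathcomp Require Import finmap.
From mathcomp Require Import all_classical all_reals all_analysis.

Set Implicit Arguments.
Unset Strict Implicit.
Unset Printing Implicit Defensive.

Import Order.TTheory GRing.Theory Num.Theory.
Local Open Scope classical_set_scope.
Local Open Scope ring_scope.

(* The norm that the library puts on matrices is the sup norm, hence this
   definition of the Euclidean one. *)
Definition l2norm (R : realType) (d : nat) (x : 'cV[R]_d) : R :=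
  Num.sqrt (\sum_(i < d) x i 0 ^+ 2).

(* [a] stands for the measure sum_x a(x) delta_x; its support is [finsupp a]. *)
Definition is_distribution (R : realType) (d : nat)
    (a : {fsfun 'cV[R]_d -> R with 0}) : Prop :=
  (forall x, 0 <= a x) /\ \sum_(x <- finsupp a) a x = 1.

(* Couplings of sum_x a(x) delta_x with sum_j b_j delta_(nu^j): [g x j] is the
   mass sent from x to nu^j. The row condition forces g to vanish off the
   support of a. *)
Definition coupling (R : realType) (d n : nat)
    (a : {fsfun 'cV[R]_d -> R with 0}) (b : 'I_n -> R)
    (g : 'cV[R]_d -> 'I_n -> R) : Prop :=
  [/\ forall x j, 0 <= g x j,
      forall x, \sum_(j < n) g x j = a x &
      forall j, \sum_(x <- finsupp a) g x j = b j].

Definition transport_cost (R : realType) (d n : nat) (p : R)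
    (a : {fsfun 'cV[R]_d -> R with 0}) (nu : 'I_n -> 'cV[R]_d)
    (g : 'cV[R]_d -> 'I_n -> R) : R :=
  \sum_(x <- finsupp a) \sum_(j < n) g x j * l2norm (x - nu j) `^ p.

(* The couplings attaining W_p(a, sum_j b_j delta_(nu^j))^p. *)
Definition optimal_coupling (R : realType) (d n : nat) (p : R)
    (a : {fsfun 'cV[R]_d -> R with 0}) (b : 'I_n -> R)
    (nu : 'I_n -> 'cV[R]_d) (g : 'cV[R]_d -> 'I_n -> R) : Prop :=
  coupling a b g /\
  forall g', coupling a b g' ->
    transport_cost p a nu g <= transport_cost p a nu g'.

(* Some b_j may be 0, so that nu ranges over the distributions supported on at
   most n points. A point x lying in the supports of several mu_i sends to nu^j
   the total of the masses prescribed by the k couplings. *)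
Definition is_solution (R : realType) (d n k : nat) (p : R)
    (mu : 'I_k -> {fsfun 'cV[R]_d -> R with 0})
    (S : 'I_n -> {fset 'cV[R]_d}) (w : 'I_n -> 'cV[R]_d -> R) : Prop :=
  exists (nu : 'I_n -> 'cV[R]_d) (b : 'I_n -> R)
         (g : 'I_k -> 'cV[R]_d -> 'I_n -> R),
    [/\ (forall j, 0 <= b j) /\ \sum_(j < n) b j = 1,
        forall i, optimal_coupling p (mu i) b nu (g i),
        forall j x, w j x = \sum_(i < k) g i x j &
        forall j x, (x \in S j) = (0 < w j x)].

(* Cost of (S, w) after mapping the points through f; the centers range over
   the codomain of f. *)
Definition image_cost (R : realType) (d m n : nat) (k : nat) (p : R)
    (f : 'cV[R]_d -> 'cV[R]_m)
    (S : 'I_n -> {fset 'cV[R]_d}) (w : 'I_n -> 'cV[R]_d -> R) : R :=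
  inf (range (fun nu : 'I_n -> 'cV[R]_m =>
    k%:R^-1 * \sum_(j < n) \sum_(x <- S j) w j x * l2norm (f x - nu j) `^ p)).

Definition cost (R : realType) (d n : nat) (k : nat) (p : R)
    (S : 'I_n -> {fset 'cV[R]_d}) (w : 'I_n -> 'cV[R]_d -> R) : R :=
  image_cost k p idfun S w.

Definition proj_cost (R : realType) (d m n : nat) (k : nat) (p : R)
    (M : 'M[R]_(m, d))
    (S : 'I_n -> {fset 'cV[R]_d}) (w : 'I_n -> 'cV[R]_d -> R) : R :=
  image_cost k p (mulmx M) S w.

(* A random m x d matrix with the Johnson-Lindenstrauss guarantee, C0 being the
   constant hidden in m = O(log(N/delta)/eps^2). *)
Definition JL_projection (R : realType) (C0 : R) (disp : measure_display)
    (T : measurableType disp) (P : probability T R) (d m : nat)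
    (pi : T -> 'M[R]_(m, d)) : Prop :=
  (forall i j, measurable_fun [set: T] (fun t => pi t i j)) /\
  forall (N : nat) (x : 'I_N -> 'cV[R]_d) (eps delta : R),
    (0 < N)%N -> 0 < eps < 1 -> 0 < delta < 1 ->
    C0 * (ln (N%:R / delta) / eps ^+ 2) <= m%:R ->
    ((1 - delta)%:E <= P [set t | (forall i j : 'I_N,
       (1 - eps) * l2norm (x i - x j)
         <= l2norm (pi t *m x i - pi t *m x j)
         <= (1 + eps) * l2norm (x i - x j))%R])%E.

(* Main.v *)
(**
  For p = 2 the optimal center of a cluster is its weighted mean, and the cost
  of a cluster of mass W is (2 W)^-1 sum_(x, y) w(x) w(y) |x - y|^2. Costs thus
  depend only on pairwise distances, and every solution only involves points of
  the union of the supports. That union has N <= k A n^c <= (n k)^(A + c + 1)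
  points, hence ln (N / delta) <= (A + c + 1) ln (n k / delta), and the
  Johnson-Lindenstrauss event for these N points is contained in the event of
  the theorem. The latter is an intersection over uncountably many solutions;
  it is measurable because each of them imposes a closed condition on the
  matrix.
*)

Require Import Defs.
From HB Require Import structures.
From mathcomp Require Import all_boot all_order all_algebra.
From mathcomp Require Import finmap.
From mathcomp Require Import all_classical all_reals all_analysis.
From mathcomp Require Import ring lra.

Set Implicit Arguments.
Unset Strict Implicit.
Unset Printing Implicit Defensive.

Import Order.TTheory GRing.Theory Num.Theory.
Import numFieldNormedType.Exports.
Local Open Scope classical_set_scope.
Local Open Scope ring_scope.

(** * Preimages of open and closed sets of matrices under a random matrix *)

Section measurability.
Context (R : realType) (disp : measure_display) (T : measurableType disp).
Context (m d : nat) (pi : T -> 'M[R]_(m, d)).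
Hypothesis pi_meas : forall i j, measurable_fun [set: T] (fun t => pi t i j).

Lemma measurable_preimage_mx_ball (Q : 'M[R]_(m, d)) (r : R) :
  measurable [set t | forall i j, ball (Q i j) r (pi t i j)].
Proof.
have -> : [set t | forall i j, ball (Q i j) r (pi t i j)] =
    \bigcap_(ij : 'I_m * 'I_d) ((fun t => pi t ij.1 ij.2) @^-1` ball (Q ij.1 ij.2) r).
  apply/seteqP; split => [t h [i j] _ | t h i j]; first exact: h.
  exact: (h (i, j)).
apply: fin_bigcap_measurable => [|[i j] _]; first exact: finite_finset.
rewrite -[X in measurable X]setTI; apply: pi_meas => //.
exact: measurable_realfun.measurable_ball.
Qed.

(** Entrywise balls with rational centers and radii [1/(N+1)] form a countable base, so an open set
    is the union of the countably many of them that it contains. *)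
Lemma measurable_preimage_mx_open (O : set 'M[R]_(m, d)) :
  open O -> measurable (pi @^-1` O).
Proof.
move=> oO; pose B (u : 'M[rat]_(m, d) * nat) : set 'M[R]_(m, d) :=
  [set M | forall i j, ball (ratr (u.1 i j) : R) u.2.+1%:R^-1 (M i j)].
have -> : pi @^-1` O =
    \bigcup_u (if `[< B u `<=` O >] then pi @^-1` B u else set0).
  apply/seteqP; split => [t Ot | t [u _]]; last first.
    by case: asboolP => // BO /BO.
  have /nbhs_ballP[e /= e0 eO] : nbhs (pi t) O by exact: open_nbhs_nbhs.
  (* Half of [e] suffices: a ball of radius [1/(N+1)] whose center is within [1/(N+1)] of [pi t]
     stays within [2/(N+1) < e] of [pi t]. *)
  have [N _ /(_ N (leqnn N)) Ne] : \forall n \near \oo, n.+1%:R^-1 < e / 2 :> R.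
    have e20 : 0 < e / 2 by lra.
    exact: (near_infty_natSinv_lt (PosNum e20)).
  have N0 : 0 < N.+1%:R^-1 :> R by rewrite invr_gt0.
  have q i j : {q : rat | `|ratr q - pi t i j| < N.+1%:R^-1}.
    apply: cid; have [q] := @rat_in_itvoo R (pi t i j) (pi t i j + N.+1%:R^-1) ltac:(by rewrite ltrDl).
    by rewrite in_itv /= => qh; exists q; rewrite ltr_norml; move: qh N0; set r := _^-1; lra.
  exists (\matrix_(i, j) sval (q i j), N) => //=.
  have -> : `[< B (\matrix_(i, j) sval (q i j), N) `<=` O >].
    apply/asboolP => M MB; apply: eO; split => // i j; move: (MB i j).
    rewrite /= mxE; case: (q i j) => z /= zh; rewrite -!ball_normE /=.
    by move: zh Ne; rewrite !ltr_norml; set r := _.+1%:R^-1; lra.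
  by move=> i j; rewrite /= mxE; case: (q i j) => z /= zh; rewrite -ball_normE.
apply: countable_bigcupT_measurable => [|u]; first exact: countableP.
case: ifP => // _.
have := measurable_preimage_mx_ball (map_mx ratr u.1) u.2.+1%:R^-1.
by congr measurable; apply/seteqP; split => t h i j; move: (h i j); rewrite mxE.
Qed.

Lemma measurable_preimage_mx_closed (F : set 'M[R]_(m, d)) :
  closed F -> measurable (pi @^-1` F).
Proof.
move=> cF; rewrite -[F]setCK preimage_setC; apply: measurableC.
by apply: (@measurable_preimage_mx_open (~` F)); rewrite openC.
Qed.

End measurability.

Lemma closed_between (X : topologicalType) (R : realType) (f : X -> R) (a b : R) :
  continuous f -> closed [set x | a <= f x <= b].
Proof.
move=> /continuous_closedP cf.
have -> : [set x | a <= f x <= b] =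
    f @^-1` [set y | a <= y] `&` f @^-1` [set y | y <= b].
  by apply/seteqP; split => x /= => [/andP[]|[-> ->]].
by apply: closedI; apply: cf; [exact: closed_ge | exact: closed_le].
Qed.

Lemma continuous_mull (X : topologicalType) (R : realType) (f : X -> R) (a : R) :
  continuous f -> continuous (fun x => a * f x).
Proof.
by move=> cf x; apply: (@continuousM R _ (fun=> a) f) (cf x); exact: cst_continuous.
Qed.

(** * Euclidean norm and its continuity in the matrix *)

Section euclidean.
Context (R : realType).

Lemma l2norm_ge0 d (x : 'cV[R]_d) : 0 <= l2norm x.
Proof. exact: sqrtr_ge0. Qed.

Lemma l2norm_sqr d (x : 'cV[R]_d) : l2norm x ^+ 2 = \sum_(i < d) x i 0 ^+ 2.
Proof. by rewrite sqr_sqrtr// sumr_ge0// => i _; exact: sqr_ge0. Qed.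

Lemma powR_l2norm d (x : 'cV[R]_d) : l2norm x `^ 2 = l2norm x ^+ 2.
Proof. by rewrite powR_mulrn// l2norm_ge0. Qed.

Lemma continuous_l2norm_mulmxB m d (x y : 'cV[R]_d) :
  continuous (fun M : 'M[R]_(m, d) => l2norm (M *m x - M *m y)).
Proof.
move=> M; rewrite /l2norm.
apply: (@continuous_comp _ _ _
  (fun M : 'M[R]_(m, d) => \sum_(i < m) (M *m x - M *m y) i 0 ^+ 2) Num.sqrt).
  apply: continuous_big => [|i _]; first exact: add_continuous.
  under eq_fun do rewrite -mulmxBr mxE.
  move=> {}M; apply: (@continuous_comp _ _ _ _ (fun z : R => z ^+ 2));
    last exact: exprn_continuous.
  apply: continuous_big => [|j _ {}M]; first exact: add_continuous.
  apply: (@continuousM R _ (fun M : 'M[R]_(m, d) => M i j)); last exact: cst_continuous.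
  exact: (@coord_continuous R m d i j M).
exact: sqrt_continuous.
Qed.

End euclidean.

(** * Variance decomposition of a weighted cluster *)

Section clusters.
Context (R : realType) (I : choiceType).

Let mass (s : seq I) (w : I -> R) := \sum_(x <- s) w x.

Lemma sum_sqr_dist_split (s : seq I) (w h : I -> R) (c : R) : mass s w != 0 ->
  \sum_(x <- s) w x * (h x - c) ^+ 2 =
  (2 * mass s w)^-1 *
    (\sum_(x <- s) \sum_(y <- s) w x * w y * (h x - h y) ^+ 2)
  + mass s w * (c - (mass s w)^-1 * \sum_(x <- s) w x * h x) ^+ 2.
Proof.
move=> W0; set W := mass s w in W0 *.
pose s1 := \sum_(x <- s) w x * h x; pose s2 := \sum_(x <- s) w x * h x ^+ 2.
(* Used twice: at [a = c] for the left-hand side, and at [a = h x] for the inner sum over [y].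
   Everything then becomes an identity in the moments [W], [s1], [s2]. *)
have quad a : \sum_(x <- s) w x * (h x - a) ^+ 2 = s2 - 2 * a * s1 + a ^+ 2 * W.
  rewrite /s2 /s1 /W /mass !mulr_sumr -sumrB -big_split /=.
  by apply: eq_bigr => x _; ring.
have -> : \sum_(x <- s) \sum_(y <- s) w x * w y * (h x - h y) ^+ 2 =
    2 * (W * s2 - s1 ^+ 2).
  transitivity (\sum_(x <- s) (w x * s2 - 2 * s1 * (w x * h x) + W * (w x * h x ^+ 2))).
    apply: eq_bigr => x _; transitivity (w x * \sum_(y <- s) w y * (h y - h x) ^+ 2).
      by rewrite mulr_sumr; apply: eq_bigr => y _; ring.
    by rewrite quad; ring.
  rewrite big_split sumrB /= -mulr_suml -!mulr_sumr -/s1 -/s2 -/(mass s w) -/W.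
  by ring.
by rewrite quad -/s1; field.
Qed.

(** The scalar identity summed over coordinates. The center [c] occurs only in the last term, which
    is why the weighted mean is optimal when the mass is positive. *)
Lemma sum_l2norm_split m (f : I -> 'cV[R]_m) (s : seq I) (w : I -> R)
    (c : 'cV[R]_m) : mass s w != 0 ->
  \sum_(x <- s) w x * l2norm (f x - c) ^+ 2 =
  (2 * mass s w)^-1 *
    (\sum_(x <- s) \sum_(y <- s) w x * w y * l2norm (f x - f y) ^+ 2)
  + mass s w * l2norm (c - (mass s w)^-1 *: \sum_(x <- s) w x *: f x) ^+ 2.
Proof.
move=> W0.
transitivity (\sum_(i < m) \sum_(x <- s) w x * (f x i 0 - c i 0) ^+ 2).
  rewrite exchange_big; apply: eq_bigr => x _; rewrite l2norm_sqr mulr_sumr.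
  by apply: eq_bigr => i _; rewrite !mxE.
under eq_bigr => i _ do rewrite (sum_sqr_dist_split (fun x => f x i 0))//.
rewrite big_split /= -!mulr_sumr l2norm_sqr; congr (_ * _ + _ * _).
  rewrite exchange_big; apply: eq_bigr => x _; rewrite exchange_big.
  apply: eq_bigr => y _; rewrite l2norm_sqr -mulr_sumr; congr (_ * _).
  by apply: eq_bigr => i _; rewrite !mxE.
apply: eq_bigr => i _; rewrite !mxE summxE.
by under [in RHS]eq_bigr do rewrite mxE.
Qed.

End clusters.

(** * Closed form of the cost in terms of pairwise distances *)

Section image_cost.
Context (R : realType) (d m n k : nat).
Variables (S : 'I_n -> {fset 'cV[R]_d}) (w : 'I_n -> 'cV[R]_d -> R).
Hypothesis w_gt0 : forall j x, x \in S j -> 0 < w j x.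

Let mass j := \sum_(x <- S j) w j x.

Let mass_ge0 j : 0 <= mass j.
Proof. by rewrite /mass big_seq sumr_ge0// => x /w_gt0/ltW. Qed.

Let mass_eq0 j : mass j = 0 -> S j = fset0.
Proof.
move=> W0; apply/eqP; apply: contraT => /fset0Pn[x xS].
suff : 0 < mass j by rewrite W0 ltxx.
rewrite /mass (big_fsetD1 x)//= ltr_pwDl ?w_gt0//.
by rewrite big_seq sumr_ge0// => y /fsetD1P[_ /w_gt0/ltW].
Qed.

Lemma image_costE (f : 'cV[R]_d -> 'cV[R]_m) :
  image_cost k 2 f S w = k%:R^-1 * \sum_(j < n) (2 * mass j)^-1 *
    \sum_(x <- S j) \sum_(y <- S j) w j x * w j y * l2norm (f x - f y) ^+ 2.
Proof.
pose D j := (2 * mass j)^-1 *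
  \sum_(x <- S j) \sum_(y <- S j) w j x * w j y * l2norm (f x - f y) ^+ 2.
pose mean j := (mass j)^-1 *: \sum_(x <- S j) w j x *: f x.
have clusterE j c : \sum_(x <- S j) w j x * l2norm (f x - c) `^ 2 =
    D j + mass j * l2norm (c - mean j) ^+ 2.
  under eq_bigr do rewrite powR_l2norm.
  (* The decomposition divides by the mass. If the mass is 0, positivity of the weights makes the
     cluster empty, and all terms are 0. *)
  have [W0|W0] := eqVneq (mass j) 0; last exact: sum_l2norm_split.
  by rewrite /D W0 (mass_eq0 W0) !big_seq_fset0 mulr0 mul0r addr0.
apply/eqP; rewrite eq_le; apply/andP; split.
  apply: ge_inf; last first.
    exists mean => //; congr (_ * _); apply: eq_bigr => j _.
    by rewrite clusterE subrr l2norm_sqr big1 ?mulr0 ?addr0// => i _; rewrite mxE expr0n.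
  (* [inf] is known to bound a set from below only if the set has some lower bound; here 0 is
     one. *)
  exists 0 => _ [nu _ <-]; rewrite mulr_ge0 ?invr_ge0//.
  rewrite sumr_ge0// => j _; rewrite big_seq sumr_ge0// => x xS.
  by rewrite mulr_ge0 ?powR_ge0// ltW// w_gt0.
apply: lb_le_inf => [|_ [nu _ <-]]; first by eexists; exists mean.
rewrite ler_wpM2l ?invr_ge0//; apply: ler_sum => j _.
by rewrite clusterE lerDl mulr_ge0 ?sqr_ge0.
Qed.

End image_cost.

(** * Continuity and distortion of the projected cost *)

Section distortion.
Context (R : realType) (d m n k : nat).
Variables (S : 'I_n -> {fset 'cV[R]_d}) (w : 'I_n -> 'cV[R]_d -> R).
Hypothesis w_gt0 : forall j x, x \in S j -> 0 < w j x.

(** Continuity is not visible on an infimum over all centers, but the closed form is a finite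
    combination of squared norms, each continuous in [M]. *)
Lemma continuous_proj_cost :
  continuous (fun M : 'M[R]_(m, d) => proj_cost k 2 M S w).
Proof.
under eq_fun do rewrite /proj_cost image_costE//.
apply/continuous_mull/continuous_big => [|j _]; first exact: add_continuous.
apply/continuous_mull/continuous_big => [|x _]; first exact: add_continuous.
apply: continuous_big => [|y _]; first exact: add_continuous.
apply: continuous_mull => M.
apply: (@continuous_comp _ _ _
  (fun M : 'M[R]_(m, d) => l2norm (M *m x - M *m y)) (fun z : R => z ^+ 2));
  [exact: continuous_l2norm_mulmxB | exact: exprn_continuous].
Qed.

Lemma proj_cost_distortion (eps : R) (M : 'M[R]_(m, d)) : 0 < eps < 1 ->
  (forall j x y, x \in S j -> y \in S j ->
    (1 - eps) * l2norm (x - y) <= l2norm (M *m x - M *m y)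
      <= (1 + eps) * l2norm (x - y)) ->
  (1 - eps) ^+ 2 * cost k 2 S w <= proj_cost k 2 M S w
    <= (1 + eps) ^+ 2 * cost k 2 S w.
Proof.
move=> /andP[e0 e1] hM; rewrite /cost /proj_cost !image_costE//.
(* Both bounds are instances of this: the closed form is linear in the squared distances, with
   nonnegative coefficients. *)
have scale (a : R) (F G : 'I_n -> 'cV[R]_d -> 'cV[R]_d -> R) :
    (forall j x y, x \in S j -> y \in S j -> F j x y <= a * G j x y) ->
    k%:R^-1 * \sum_(j < n) (2 * \sum_(x <- S j) w j x)^-1 *
      \sum_(x <- S j) \sum_(y <- S j) w j x * w j y * F j x y
    <= a * (k%:R^-1 * \sum_(j < n) (2 * \sum_(x <- S j) w j x)^-1 *
      \sum_(x <- S j) \sum_(y <- S j) w j x * w j y * G j x y).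
  move=> FG; rewrite mulrCA ler_wpM2l ?invr_ge0// mulr_sumr ler_sum// => j _.
  rewrite mulrCA ler_wpM2l//.
    by rewrite invr_ge0 mulr_ge0// big_seq sumr_ge0// => x /w_gt0/ltW.
  rewrite mulr_sumr big_seq [leRHS]big_seq ler_sum// => x xS.
  rewrite mulr_sumr big_seq [leRHS]big_seq ler_sum// => y yS.
  by rewrite [leRHS]mulrCA ler_wpM2l ?FG// mulr_ge0// ltW// w_gt0.
have e1ge0 : 0 < 1 - eps by lra.
apply/andP; split; last first.
  apply: scale => j x y xS yS; have /andP[_ hu] := hM j x y xS yS.
  by rewrite -exprMn lerXn2r// nnegrE ?mulr_ge0 ?l2norm_ge0//; lra.
(* The lower bound is [scale] with the two costs exchanged and the factor [((1 - eps) ^+ 2)^-1],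
   legitimate since [1 - eps > 0]. *)
rewrite -ler_pdivlMl ?exprn_gt0//; apply: scale => j x y xS yS; have /andP[hl _] := hM j x y xS yS.
by rewrite ler_pdivlMl ?exprn_gt0// -exprMn lerXn2r// nnegrE ?mulr_ge0 ?l2norm_ge0// ltW.
Qed.

End distortion.

(** * Points used by solutions, their number, and the inclusion of events *)

Lemma is_solution_mass (R : realType) (d n k : nat) (p : R)
    (mu : 'I_k -> {fsfun 'cV[R]_d -> R with 0})
    (S : 'I_n -> {fset 'cV[R]_d}) (w : 'I_n -> 'cV[R]_d -> R) :
  is_solution p mu S w -> forall j x, x \in S j ->
  0 < w j x /\ exists i, x \in finsupp (mu i).
Proof.
move=> [nu [b [g [_ optg wE SE]]]] j x; rewrite SE => w0; split => //.
(* Off the support of [mu i], the nonnegative entries of row [x] of the coupling sum to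
   [mu i x = 0], so each vanishes; outside all supports [w j x] would be 0. *)
apply: contrapT => /forallNP xmu; move: w0; rewrite wE big1 ?ltxx// => i _.
have [[g0 grow _] _] := optg i.
have mu0 : mu i x = 0 by apply/fsfun_dflt/negP/xmu.
have /eqP := grow x; rewrite mu0 psumr_eq0// => /allP/(_ j).
by rewrite mem_index_enum => /(_ isT)/eqP.
Qed.

(** With [b = n * k >= 2], multiply [A < b ^ A], [n ^ c <= b ^ c] and [k <= b]. *)
Lemma poly_support_leq (A c n k : nat) :
  (1 < n * k)%N -> (k * (A * n ^ c) <= (n * k) ^ (A + c + 1))%N.
Proof.
move=> nk; have n0 : (0 < n)%N by case: n nk.
have k0 : (0 < k)%N by case: k nk => //; rewrite muln0.
rewrite mulnC !expnD expn1 leq_mul// ?leq_pmull// leq_mul//.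
  exact/ltnW/ltn_expl.
by case: (c) => // c'; rewrite leq_exp2r ?leq_pmulr.
Qed.

Theorem theorem2 (R : realType) (C0 : R) (hC0 : 0 < C0) (A c : nat) :
  exists C : R, 0 < C /\
    forall (n k d m : nat) (mu : 'I_k -> {fsfun 'cV[R]_d -> R with 0})
      (eps delta : R) (disp : measure_display) (T : measurableType disp)
      (P : probability T R) (pi : T -> 'M[R]_(m, d)),
    (1 < n * k)%N ->
    (forall i, is_distribution (mu i)) ->
    (forall i, (#|` finsupp (mu i)| <= A * n ^ c)%N) ->
    0 < eps < 1 -> 0 < delta < 1 ->
    JL_projection C0 P pi ->
    C * (ln ((n * k)%:R / delta) / eps ^+ 2) <= m%:R ->
    ((1 - delta)%:E <= P [set t |
       (forall (S : 'I_n -> {fset 'cV[R]_d}) (w : 'I_n -> 'cV[R]_d -> R),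
         is_solution 2 mu S w ->
         (1 - eps) ^+ 2 * cost k 2 S w
           <= proj_cost k 2 (pi t) S w
           <= (1 + eps) ^+ 2 * cost k 2 S w)%R])%E.
Proof.
(* [A + c + 1] is the exponent in [poly_support_leq]; the logarithm turns it into a factor. *)
exists (C0 * (A + c + 1)%:R); split; first by rewrite mulr_gt0// ltr0n addn1.
move=> n k d m mu eps delta disp T P pi nk mu_distr mu_supp heps hdelta [pi_meas JL] hm.
pose s := flatten [seq (finsupp (mu i) : seq 'cV[R]_d) | i <- enum 'I_k].
have s_mem i x : x \in finsupp (mu i) -> x \in s.
  by move=> xi; apply/flatten_mapP; exists i => //; rewrite mem_enum.
have s_tnth i x : x \in finsupp (mu i) -> exists i', x = tnth (in_tuple s) i'.
  by move=> /s_mem xs; apply/tnthP.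
(* The guarantee is only available for a nonempty family; a distribution of total mass 1 has a
   nonempty support. *)
have s_gt0 : (0 < size s)%N.
  have k0 : (0 < k)%N by move: nk; rewrite lt0n; apply: contraTneq => ->; rewrite muln0.
  have [_] := mu_distr (Ordinal k0); set F := finsupp _.
  case: (fset_0Vmem F) => [->|[x /s_mem xs] _]; last by rewrite lt0n; apply: contraTneq xs => /size0nil ->.
  by rewrite big_seq_fset0 => /esym/eqP; rewrite oner_eq0.
have s_size : (size s <= k * (A * n ^ c))%N.
  rewrite size_flatten /shape -map_comp sumnE big_map big_enum /=.
  by rewrite -[k in leqRHS]card_ord -sum_nat_const; apply: leq_sum => i _; exact: mu_supp.
have /(JL (size s) (tnth (in_tuple s)) eps delta s_gt0 heps hdelta) JLs :
    C0 * (ln ((size s)%:R / delta) / eps ^+ 2) <= m%:R.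
  apply: le_trans hm; rewrite -mulrA ler_pM2l// mulrA.
  rewrite ler_wpM2r ?invr_ge0 ?sqr_ge0//.
  have [/andP[e0 e1] /andP[d0 d1]] := (heps, hdelta).
  have nk0 : (0 < n * k)%N := ltnW nk.
  rewrite [leRHS]mulr_natl -lnXn ?divr_gt0 ?ltr0n//.
  rewrite ler_ln ?posrE ?exprn_gt0 ?divr_gt0 ?ltr0n//.
  rewrite expr_div_n -natrX ler_pM// ?invr_ge0 ?(ltW d0)//.
    by rewrite ler_nat (leq_trans s_size)// poly_support_leq.
  (* As [delta < 1], raising [delta] to the power [A + c + 1] only decreases it, so [1 / delta] is
     at most the same power of itself. *)
  rewrite lef_pV2 ?posrE ?exprn_gt0// addn1 exprS.
  by rewrite ger_pMr// exprn_ile1// ltW.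
apply: (le_trans JLs); apply: le_measure; rewrite ?inE.
- pose F := \bigcap_(ij : 'I_(size s) * 'I_(size s))
    [set M : 'M[R]_(m, d) |
      (1 - eps) * l2norm (tnth (in_tuple s) ij.1 - tnth (in_tuple s) ij.2)
      <= l2norm (M *m tnth (in_tuple s) ij.1 - M *m tnth (in_tuple s) ij.2)
      <= (1 + eps) * l2norm (tnth (in_tuple s) ij.1 - tnth (in_tuple s) ij.2)].
  rewrite [X in measurable X](_ : _ = pi @^-1` F).
    apply: measurable_preimage_mx_closed => //; apply: closed_bigI => ij _.
    exact/closed_between/continuous_l2norm_mulmxB.
  by apply/seteqP; split => [t h [i j] _|t h i j]; [exact: h | exact: (h (i, j))].
(* The uncountable intersection is taken among closed sets of matrices, where it remains closed, and
   only then pulled back along [pi]. *)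
- pose F := \bigcap_(Sw in [set Sw : ('I_n -> {fset 'cV[R]_d}) * ('I_n -> 'cV[R]_d -> R) |
      is_solution 2 mu Sw.1 Sw.2])
    [set M : 'M[R]_(m, d) | (1 - eps) ^+ 2 * cost k 2 Sw.1 Sw.2
      <= proj_cost k 2 M Sw.1 Sw.2 <= (1 + eps) ^+ 2 * cost k 2 Sw.1 Sw.2].
  rewrite [X in measurable X](_ : _ = pi @^-1` F).
    apply: measurable_preimage_mx_closed => //; apply: closed_bigI => -[S w] /= Sw.
    apply/closed_between/continuous_proj_cost => j x.
    by case/(is_solution_mass Sw).
  by apply/seteqP; split => [t h [S w]|t h S w]; [exact: h | exact: (h (S, w))].
- move=> t /= ht S w Sw.
  apply: proj_cost_distortion => // [j x|j x y]; first by case/(is_solution_mass Sw).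
  move=> /(is_solution_mass Sw)[_ [_ /s_tnth[i ->]]].
  move=> /(is_solution_mass Sw)[_ [_ /s_tnth[i' ->]]].
  exact: ht.
Qed.
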